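(* Let $n$ be a positive integer, $k\in\{1,2,\dots,n-1\}$, $p<0$ and $k-1<a<k$. Then the polynomial $K_n(x;p,a)$ (in the variable $x$) has at least $n-k$ zeros in $(0,\infty)$.
   Context: The Pochhammer symbol is $(\alpha)_0=1$ and $(\alpha)_m=\alpha(\alpha+1)\cdots(\alpha+m-1)$ for $m\ge 1$. For $n\in\{0,1,2,\dots\}$, $a\in\mathbb{R}$ and real $p\neq 0$, the polynomial $K_n(x;p,a)$ of degree $n$ in $x$ is given by $$K_n(x;p,a)=\sum_{k=0}^n\frac{(-n)_k(-x)_k(-a+k)_{n-k}}{k!\,p^k}.$$ *)

(* Defs.v *)
From mathcomp Require Import all_boot all_order all_algebra.
From mathcomp Require Import all_classical all_reals.
Set Implicit Arguments.
Unset Strict Implicit.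
Unset Printing Implicit Defensive.
Import Order.TTheory GRing.Theory Num.Theory.
Local Open Scope ring_scope.

(* Stated over a general ring because it is used both for scalars and for the
   polynomial argument [- 'X]. *)
Definition pochhammer (A : comNzRingType) (x : A) (m : nat) : A :=
  \prod_(i < m) (x + i%:R).

Definition K_poly (R : realType) (n : nat) (p a : R) : {poly R} :=
  \sum_(k < n.+1)
    (pochhammer (- n%:R) k * pochhammer (- a + k%:R) (n - k)
       / (k`!%:R * p ^+ k)) *: pochhammer (- 'X) k.

Lemma horner_pochhammerNX (R : realType) (k : nat) (x : R) :
  (pochhammer (- 'X) k).[x] = pochhammer (- x) k.
Proof.
rewrite /pochhammer horner_prod; apply: eq_bigr => i _.
by rewrite hornerD hornerN hornerX -polyC_natr hornerC.
Qed.

Lemma horner_K_poly (R : realType) (n : nat) (p a x : R) :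
  (K_poly n p a).[x] =
  \sum_(k < n.+1)
    pochhammer (- n%:R) k * pochhammer (- x) k
      * pochhammer (- a + k%:R) (n - k) / (k`!%:R * p ^+ k).
Proof.
rewrite /K_poly horner_sum; apply: eq_bigr => k _.
by rewrite hornerZ horner_pochhammerNX mulrAC [X in X / _]mulrAC.
Qed.

(* Main.v *)
Require Import Defs.
From mathcomp Require Import all_boot all_order all_algebra.
From mathcomp Require Import all_classical all_reals.
From mathcomp Require Import topology normedtype sequences.
From mathcomp Require Import polyrcf.
From mathcomp Require Import ring lra zify.
Set Implicit Arguments.
Unset Strict Implicit.
Unset Printing Implicit Defensive.
Import Order.TTheory GRing.Theory Num.Theory numFieldNormedType.Exports.
Local Open Scope ring_scope.

(** The polynomials [K_poly n p a] are Meixner polynomials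
    2F1(-n, -x; b; 1 - 1/c), multiplied by (b)_n, with b = -a and
    c = p / (p - 1); the condition p < 0 says that 0 < c < 1.  For b > 0 they
    are orthogonal for the weight (b)_x c^x / x! on the natural numbers and
    have n positive zeros.  Here k - 1 < a < k, so b is negative and the weight
    changes sign, but only between neighbours in {0, ..., k}, which costs at
    most k zeros.

    Rather than orthogonality, the proof counts sign changes in the Rodrigues
    formula ([meixner_rodrigues])

      (b)_x c^x / x! * K_n(x) = nabla^n [ (b)_{n+x} c^x / x! ],

    where nabla is the backward difference of sequences on the natural
    numbers, extended by 0 at -1.  The bracket tends to 0 at infinity because
    c < 1 ([pochhammer_power_cvg0]).  By a discrete Rolle argument, nabla adds
    a sign change to every nonzero sequence that vanishes at both ends
    ([nabla_sign_alt]), so the right-hand side takes alternating signs at some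
    integers x_0 < ... < x_n.  Discarding the first k of them leaves points
    that are at least k, where the weight has a constant sign
    ([pochhammer_sign]); hence K_n itself alternates at the n - k + 1 remaining
    points, and the intermediate value theorem gives a zero between each two
    neighbours ([sign_alt_roots]). *)

(** * Alternating sequences and zeros of polynomials *)

(** Strict sign changes of [f] are recorded as paths: [path (sign_alt f) i s]
    holds when [i :: s] increases and [f] takes values of alternating signs
    along it, so that [size s] counts the sign changes.  When [s] is empty
    nothing is said of [f i], whence the separate hypotheses [f i != 0] below. *)
Definition sign_alt (R : numDomainType) (f : nat -> R) : rel nat :=
  fun i j => (i < j)%N && (f i * f j < 0).

Lemma sign_alt_ltn (R : numDomainType) (f : nat -> R) i s :
  path (sign_alt f) i s -> path ltn i s.
Proof. by apply: sub_path => x y /andP[]. Qed.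

(** This is why getting rid of all the points below [k] costs at most [k]
    points: distinct naturals increase by at least 1 at each step. *)
Lemma path_ltn_drop k i s :
  path ltn i s -> all (leq (i + k)) (drop k (i :: s)).
Proof.
elim: k i s => [|k IHk] i s.
  move=> /(order_path_min ltn_trans) lt_is; rewrite drop0 addn0 /= leqnn /=.
  by apply: sub_all lt_is => x /ltnW.
case: s => [|j s] //= /andP[lt_ij js]; apply: sub_all (IHk j s js) => x.
lia.
Qed.

(** The zeros come from disjoint intervals between consecutive points, hence
    are distinct; the lower bound [i%:R < x] is what makes the induction give
    uniqueness. *)
Lemma sign_alt_roots (R : rcfType) (q : {poly R}) i s :
  path (sign_alt (fun m => q.[m%:R])) i s ->
  exists r : seq R,
    [/\ uniq r, size r = size s & forall x, x \in r -> i%:R < x /\ root q x].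
Proof.
elim: s i => [|j s IHs] i /=; first by exists [::].
case/andP=> /andP[lt_ij q_lt0] /IHs[r [r_uniq r_size rP]].
have le_ij : i%:R <= j%:R :> R by rewrite ler_nat ltnW.
have [x /andP[ix xj] qx] := poly_ivtoo le_ij q_lt0.
exists (x :: r); split=> /=; last 1 first.
- move=> y; rewrite inE => /orP[/eqP -> // |/rP[jy qy]]; split=> //.
  exact: le_lt_trans jy.
- rewrite r_uniq andbT; apply/negP => /rP[jx _].
  by have := lt_trans xj jx; rewrite ltxx.
- by rewrite r_size.
Qed.

(** * Backward differences create sign changes *)

(** The value at 0 treats the sequence as extended by 0 at -1; this is the zero
    of the sequence at its left end in the discrete Rolle argument. *)
Definition nabla (V : zmodType) (f : nat -> V) : nat -> V :=
  fun m => if m is m'.+1 then f m - f m' else f 0%N.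

Lemma iter_nablaZ (A : pzRingType) (b : A) (f : nat -> A) n x :
  iter n (@nabla A) (fun m => b * f m) x = b * iter n (@nabla A) f x.
Proof.
elim: n x => [//|n IHn] x; rewrite !iterS /nabla.
by case: x => [|x]; rewrite !IHn ?mulrBr.
Qed.

Lemma nabla_cvg0 (R : realType) (f : nat -> R) :
  (f @ \oo --> 0)%classic -> (nabla f @ \oo --> 0)%classic.
Proof.
move=> f0; have fS0 : ((fun m => f m.+1) @ \oo --> 0)%classic.
  by rewrite cvg_shiftS.
have : ((fun m => f m.+1 - f m) @ \oo --> 0 - 0)%classic by apply: cvgB.
by rewrite subr0 -(cvg_shiftS (nabla f)).
Qed.

(** Discrete mean value inequality: [c * f j - c * f i] is the sum of the
    [c * nabla f l] over [i < l <= j], so one of them is negative.  The factor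
    [c] is used with [c = f i] or [c = - f i], to treat both signs at once. *)
Lemma nabla_sign_between (R : realDomainType) (f : nat -> R) (c : R) i j :
  (i <= j)%N -> c * f j < c * f i ->
  exists l, [/\ (i < l)%N, (l <= j)%N & c * nabla f l < 0].
Proof.
elim: j => [|j IHj]; first by rewrite leqn0 => /eqP ->; rewrite ltxx.
rewrite leq_eqVlt ltnS => /orP[/eqP -> |le_ij f_lt]; first by rewrite ltxx.
have [f_lt'|f_ge] := ltP (c * f j) (c * f i).
  by have [l [? ? ?]] := IHj le_ij f_lt'; exists l; split=> //; apply: leqW.
by exists j.+1; split=> //=; rewrite mulrBr subr_lt0 (lt_le_trans f_lt).
Qed.

(** Discrete Rolle, at the right end.  From each point of [i :: s] to the next,
    [f] crosses to the opposite sign, and after the last point it decays to 0;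
    each of these moves forces a value of [nabla f] of sign opposite to that of
    [f] at the point just left, so these values alternate. *)
Lemma nabla_sign_alt_from (R : realType) (f : nat -> R) i s :
  (f @ \oo --> 0)%classic -> f i != 0 -> path (sign_alt f) i s ->
  exists j t, [/\ (i < j)%N, f i * nabla f j < 0, size t = size s
                & path (sign_alt (nabla f)) j t].
Proof.
move=> f_cvg; elim: s i => [|i1 s IHs] i fi0 /=.
  (* Far enough to the right, |f| has dropped below |f i|. *)
  have fi2 : 0 < `|f i| by rewrite normr_gt0.
  have [N _ Nf] := cvgr0_norm_lt f f_cvg _ fi2.
  have lef : f i * f (maxn i N) < f i * f i.
    have /= := Nf (maxn i N) (leq_maxr i N).
    rewrite -(ltr_pM2l fi2) => /(le_lt_trans _); rewrite -!normrM.
    rewrite (ger0_norm (sqr_ge0 (f i) : 0 <= f i * f i)); apply.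
    exact: ler_norm.
  have [l [il _ fl]] := nabla_sign_between (leq_maxl i N) lef.
  by exists l, [::].
case/andP=> /andP[lt_i f_lt] alt_s.
have fi1 : f i1 != 0 by apply: contraTneq f_lt => ->; rewrite mulr0 ltxx.
have [j1 [t [lt_j1 f_j1 t_size alt_t]]] := IHs i1 fi1 alt_s.
have f_i : f i * f i1 < f i * f i.
  by rewrite (lt_trans f_lt) // lt0r mulf_neq0 //= sqr_ge0.
(* As j0 <= i1 < j1, the new point can be put in front of j1 :: t. *)
have [j0 [lt_ij0 le_j0 f_j0]] := nabla_sign_between (ltnW lt_i) f_i.
exists j0, (j1 :: t); split=> //=; first by rewrite t_size.
rewrite alt_t /sign_alt (leq_ltn_trans le_j0 lt_j1) /= andbT.
have [f_pos|f_neg|f_eq] := ltrgtP (f i) 0; nra.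
Qed.

(** Discrete Rolle, at both ends: besides the changes produced to the right of
    [i], the move of [f] from its virtual value 0 at -1 to [f i] provides a
    value of [nabla f] that has the sign of [f i], at or before [i]. *)
Lemma nabla_sign_alt (R : realType) (f : nat -> R) i s :
  (f @ \oo --> 0)%classic -> f i != 0 -> path (sign_alt f) i s ->
  exists j t, [/\ nabla f j != 0, size t = (size s).+1
                & path (sign_alt (nabla f)) j t].
Proof.
move=> f_cvg fi0 /(nabla_sign_alt_from f_cvg fi0).
case=> [j [t [lt_ij f_j t_size alt_t]]].
(* If f 0 has the sign of f i, then l = 0 works since nabla f 0 = f 0. *)
have [l [le_li f_l]] : exists l, (l <= i)%N /\ 0 < f i * nabla f l.
  have [f_pos|f_neg] := ltP 0 (f i * f 0%N); first by exists 0%N.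
  have : - f i * f i < - f i * f 0%N.
    have : 0 < f i ^+ 2 by rewrite lt0r sqrf_eq0 fi0 sqr_ge0.
    lra.
  case/(nabla_sign_between (leq0n i)) => l [_ le_li]; rewrite mulNr oppr_lt0.
  by exists l.
exists l, (j :: t); split; last 2 first.
- by rewrite /= t_size.
- rewrite /= alt_t /sign_alt (leq_ltn_trans le_li lt_ij) andbT /=.
  have [f_pos|f_neg|f_eq] := ltrgtP (f i) 0; nra.
by apply: contraTneq f_l => ->; rewrite mulr0 ltxx.
Qed.

Lemma iter_nabla_sign_alt (R : realType) (f : nat -> R) n :
  (f @ \oo --> 0)%classic -> f 0%N != 0 ->
  exists i s, size s = n /\ path (sign_alt (iter n (@nabla R) f)) i s.
Proof.
move=> f_cvg f0.
suff [i [s [_ s_size alt_s]]] : exists i s,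
    [/\ iter n (@nabla R) f i != 0, size s = n
      & path (sign_alt (iter n (@nabla R) f)) i s] by exists i, s.
have cvg_iter m : (iter m (@nabla R) f @ \oo --> 0)%classic.
  by elim: m => [//|m IHm]; apply: nabla_cvg0.
elim: n => [|n [i [s [fi0 s_size alt_s]]]]; first by exists 0%N, [::].
have [j [t [fj0 t_size alt_t]]] := nabla_sign_alt (cvg_iter n) fi0 alt_s.
by exists j, t; rewrite t_size s_size.
Qed.

(** * Pochhammer symbols *)

Lemma pochhammer0 (A : comNzRingType) (x : A) : pochhammer x 0 = 1.
Proof. exact: big_ord0. Qed.

Lemma pochhammerSr (A : comNzRingType) (x : A) m :
  pochhammer x m.+1 = pochhammer x m * (x + m%:R).
Proof. exact: big_ord_recr. Qed.

Lemma pochhammerSl (A : comNzRingType) (x : A) m :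
  pochhammer x m.+1 = x * pochhammer (x + 1) m.
Proof.
rewrite /pochhammer big_ord_recl addr0; congr (_ * _).
by apply: eq_bigr => i _; rewrite -addrA -natr1 [1 + _]addrC.
Qed.

Lemma pochhammerD (A : comNzRingType) (x : A) m n :
  pochhammer x (m + n) = pochhammer x m * pochhammer (x + m%:R) n.
Proof.
elim: n => [|n IHn]; first by rewrite addn0 pochhammer0 mulr1.
by rewrite addnS !pochhammerSr IHn natrD -mulrA addrA.
Qed.

(** All factors of [(b)_k] are negative, and those that [(b)_x] has in addition
    are positive. *)
Lemma pochhammer_sign (R : realDomainType) (b : R) k x y :
  b + k%:R - 1 < 0 -> 0 < b + k%:R -> (k <= x)%N -> (k <= y)%N ->
  0 < pochhammer b x * pochhammer b y.
Proof.
move=> b_lt b_gt kx ky.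
have pk : pochhammer b k != 0.
  apply/prodf_neq0 => i _; rewrite lt_eqF //; apply: le_lt_trans b_lt.
  by rewrite -addrA lerD2l lerBrDr natr1 ler_nat.
have ppos m : 0 < pochhammer (b + k%:R) m.
  by apply: prodr_gt0 => i _; rewrite ltr_wpDr.
rewrite -(subnKC kx) -(subnKC ky) !pochhammerD mulrACA.
rewrite mulr_gt0 //; last exact: mulr_gt0.
by rewrite lt0r mulf_neq0 //= sqr_ge0.
Qed.

(** Pascal's rule: [(-n)_k / k!] is the signed binomial coefficient
    (-1)^k C(n, k). *)
Lemma pochhammer_binomial_rec (R : numFieldType) (n k : nat) :
  pochhammer (- n.+1%:R) k.+1 / k.+1`!%:R =
  pochhammer (- n%:R) k.+1 / k.+1`!%:R - pochhammer (- n%:R) k / k`!%:R :> R.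
Proof.
have k0 : k`!%:R != 0 :> R by rewrite pnatr_eq0 -lt0n fact_gt0.
have k1 : k%:R + 1 != 0 :> R by rewrite natr1 pnatr_eq0.
rewrite pochhammerSl pochhammerSr.
rewrite (_ : - n.+1%:R + 1 = - n%:R); last by rewrite -natr1 opprD addrNK.
rewrite factS natrM -!natr1; field; exact/andP.
Qed.

(** * Rodrigues formula *)

(** The backward shift relation of Meixner polynomials, with [1 - p^-1] in the
    role of 1/c; it is one application of [nabla] in the Rodrigues formula with
    the weights divided out.  On the right, [(b + x) (-x)_k] is written as
    [(b + k) (-x)_k - (-x)_{k+1}], and [x (1 - x)_k] is [- (-x)_{k+1}].  The
    two multiples of [(-x)_{k+1}] then leave only [- (-x)_{k+1} p^-1], and
    Pascal's rule identifies the coefficient of each [(-x)_k p^-k]. *)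
Lemma horner_K_polyS (R : realType) (n : nat) (p b x : R) : p != 0 ->
  (K_poly n.+1 p (- b)).[x] =
  (b + x) * (K_poly n p (- (b + 1))).[x]
    - x * (1 - p^-1) * (K_poly n p (- (b + 1))).[x - 1].
Proof.
move=> p0.
pose B m k : R := pochhammer (- m%:R) k / k`!%:R.
pose z := p^-1.
have KE m c y : (K_poly m p (- c)).[y] =
    \sum_(k < m.+1) B m k * pochhammer (c + k%:R) (m - k)
                     * (pochhammer (- y) k * z ^+ k).
  rewrite horner_K_poly; apply: eq_bigr => k _; rewrite opprK /B /z exprVn.
  by rewrite invfM; ring.
have xS k : x * pochhammer (- (x - 1)) k = - pochhammer (- x) k.+1.
  by rewrite pochhammerSl mulNr opprK opprB addrC.
pose A k := B n k * pochhammer (b + 1 + k%:R) (n - k).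
transitivity (
  \sum_(k < n.+1) (A k * ((b + k%:R) * (pochhammer (- x) k * z ^+ k)))
   - \sum_(k < n.+1) (A k * (pochhammer (- x) k.+1 * z ^+ k.+1))); last first.
  rewrite !KE !mulr_sumr -!sumrB; apply: eq_bigr => k _; rewrite -/(A k).
  transitivity (A k * z ^+ k * ((b + x) * pochhammer (- x) k
     - (1 - z) * (x * pochhammer (- (x - 1)) k))); last by rewrite /z; ring.
  by rewrite xS pochhammerSr exprS; ring.
have Bn : B n n.+1 = 0 by rewrite /B pochhammerSr addNr mulr0 mul0r.
have shift k : (k < n.+1)%N ->
    A k * (b + k%:R) = B n k * pochhammer (b + k%:R) (n.+1 - k).
  by move=> lt_k; rewrite subSn // pochhammerSl /A addrAC; ring.
have -> : \sum_(k < n.+1) (A k * ((b + k%:R) * (pochhammer (- x) k * z ^+ k))) =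
    \sum_(k < n.+2) B n k * pochhammer (b + k%:R) (n.+1 - k)
                      * (pochhammer (- x) k * z ^+ k).
  rewrite [RHS]big_ord_recr /= Bn !mul0r addr0; apply: eq_bigr => k _.
  by rewrite mulrA shift.
rewrite KE [LHS]big_ord_recl [in RHS]big_ord_recl -addrA; congr (_ + _).
  by rewrite /B /= !pochhammer0.
rewrite -sumrB; apply: eq_bigr => k _; rewrite /B lift0 pochhammer_binomial_rec.
rewrite /A /B subSS -natr1 [k%:R + 1]addrC [b + (1 + _)]addrA; ring.
Qed.

(** For [b > 0] and [0 < c < 1], the orthogonality weight of the Meixner
    polynomials (a negative binomial distribution, up to normalization). *)
Definition meixner_weight (R : fieldType) (b c : R) (x : nat) : R :=
  pochhammer b x * c ^+ x / x`!%:R.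

(** The induction raises [b] by 1: the sequence for [n.+1] and [b] is [b] times
    the one for [n] and [b + 1].  The factor [(b)_n] in the normalization of
    [K_poly] is absorbed in [(b)_{n+m}], which avoids any division by [b]. *)
Lemma meixner_rodrigues (R : realType) (n x : nat) (p b c : R) :
  p != 0 -> c != 0 -> c^-1 = 1 - p^-1 ->
  meixner_weight b c x * (K_poly n p (- b)).[x%:R] =
  iter n (@nabla R)
    (fun m => pochhammer b (n + m) * c ^+ m / m`!%:R) x.
Proof.
move=> p0 c0 cE; elim: n b x => [|n IHn] b x.
  by rewrite horner_K_poly big_ord1 /= !pochhammer0 expr0 !mulr1 divr1 mulr1.
have -> : (fun m => pochhammer b (n.+1 + m) * c ^+ m / m`!%:R) =
    fun m => b * (pochhammer (b + 1) (n + m) * c ^+ m / m`!%:R).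
  by apply/funext => m; rewrite addSn pochhammerSl !mulrA.
rewrite iterS /nabla !iter_nablaZ horner_K_polyS // -cE /meixner_weight.
case: x => [|x].
  by rewrite -IHn /meixner_weight !pochhammer0 mul0r mul0r subr0; ring.
rewrite !iter_nablaZ -!IHn /meixner_weight.
rewrite (_ : x.+1%:R - 1 = x%:R); last by rewrite -natr1 addrK.
have x0 : x`!%:R != 0 :> R by rewrite pnatr_eq0 -lt0n fact_gt0.
have x1 : x%:R + 1 != 0 :> R by rewrite natr1 pnatr_eq0.
have bS : b * pochhammer (b + 1) x = pochhammer b x.+1.
  by rewrite pochhammerSl.
have bSS : b * pochhammer (b + 1) x.+1 = pochhammer b x.+1 * (b + (x%:R + 1)).
  by rewrite -pochhammerSl pochhammerSr natr1.
rewrite !mulrA bS bSS factS natrM exprS -natr1; field.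
by rewrite c0 x0 x1.
Qed.

(** * Decay at infinity *)

Lemma ratio_cvg0 (R : realType) (f : nat -> R) (q : R) N :
  0 <= q < 1 -> (forall m, (N <= m)%N -> `|f m.+1| <= q * `|f m|) ->
  (f @ \oo --> 0)%classic.
Proof.
case/andP=> q0 q1 f_le; rewrite -(cvg_shiftn N); apply: norm_cvg0.
have q1' : `|q| < 1 by rewrite ger0_norm.
apply: (squeeze_cvgr _ (cvg_cst 0) (cvg_geometric `|f N| q1')).
apply: nearW => m /=; rewrite normr_ge0 /=.
elim: m => [|m IHm]; first by rewrite add0n expr0 mulr1.
rewrite addSn (le_trans (f_le _ (leq_addl _ _))) // exprS mulrCA.
exact: ler_wpM2l.
Qed.

(** The ratio of consecutive terms is [c (b + n + m) / (m + 1)], which tends to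
    [c < 1]; so it is eventually at most the midpoint [q] of [c] and 1. *)
Lemma pochhammer_power_cvg0 (R : realType) (b c : R) n : 0 < c < 1 ->
  ((fun m => pochhammer b (n + m) * c ^+ m / m`!%:R) @ \oo --> 0)%classic.
Proof.
case/andP=> c0 c1; pose q := (1 + c) / 2.
have [q0 q1 cq] : [/\ 0 <= q, q < 1 & c < q] by rewrite /q; split; lra.
(* For m >= M, c |b + n| <= (q - c) m, so that c |b + n + m| <= q m. *)
pose M := c * `|b + n%:R| / (q - c).
have [N MN] : exists N : nat, M <= N%:R.
  exists (Num.bound M); apply: ltW; apply: le_lt_trans (archi_boundP _) => //.
  by rewrite /M divr_ge0 ?mulr_ge0 ?subr_ge0 // ltW.
apply: (@ratio_cvg0 _ _ q N) => [|m le_Nm]; first by rewrite q0.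
rewrite addnS pochhammerSr exprS factS natrM.
have -> : pochhammer b (n + m) * (b + (n + m)%:R) * (c * c ^+ m)
            / (m.+1%:R * m`!%:R) =
    (c * (b + n%:R + m%:R) / m.+1%:R)
      * (pochhammer b (n + m) * c ^+ m / m`!%:R).
  by rewrite invfM natrD; ring.
rewrite normrM ler_wpM2r // normrM normfV [`|m.+1%:R|]ger0_norm //.
rewrite ler_pdivrMr ?ltr0n // normrM (ger0_norm (ltW c0)).
have : c * `|b + n%:R| <= (q - c) * m%:R.
  by rewrite [leRHS]mulrC -ler_pdivrMr ?subr_gt0 // (le_trans MN) // ler_nat.
have := ler_normD (b + n%:R) m%:R; rewrite [`|m%:R|]ger0_norm // -natr1 => h1.
have := ler_wpM2l (ltW c0) h1; lra.
Qed.

(** * Positive zeros *)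

Theorem corollary5 (R : realType) (n k : nat) (p a : R)
  (n_gt0 : (0 < n)%N) (k_ge1 : (1 <= k)%N) (k_le : (k <= n - 1)%N)
  (p_lt0 : p < 0) (a_gt : k%:R - 1 < a) (a_lt : a < k%:R) :
  exists s : seq R,
    [/\ uniq s, (n - k <= size s)%N &
        forall x, x \in s -> 0 < x /\ root (K_poly n p a) x].
Proof.
pose c := p / (p - 1).
have p0 : p != 0 by rewrite lt_eqF.
have p1 : p - 1 < 0 by lra.
have c0 : 0 < c by rewrite /c nmulr_lgt0 ?invr_lt0.
have c1 : c < 1 by rewrite /c ltr_ndivrMr //; lra.
have cE : c^-1 = 1 - p^-1 by rewrite /c; field; rewrite p0 lt_eqF.
have signs x y : (k <= x)%N -> (k <= y)%N ->
    0 < pochhammer (- a) x * pochhammer (- a) y.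
  by apply: pochhammer_sign; lra.
have weight_sign x y : (k <= x)%N -> (k <= y)%N ->
    0 < meixner_weight (- a) c x * meixner_weight (- a) c y.
  move=> kx ky; rewrite /meixner_weight.
  have -> (u v w u' v' w' : R) : u * v / w * (u' * v' / w') =
    u * u' * (v * v' / (w * w')) by rewrite invfM; ring.
  rewrite mulr_gt0 ?signs // divr_gt0 //.
    by rewrite mulr_gt0 ?exprn_gt0.
  by rewrite mulr_gt0 ?ltr0n ?fact_gt0.
have f0 : pochhammer (- a) (n + 0) * c ^+ 0 / 0`!%:R != 0.
  rewrite addn0 expr0 fact0 divr1 mulr1.
  have le_kn : (k <= n)%N by lia.
  by apply: contraTneq (signs n n le_kn le_kn) => ->; rewrite mulr0 ltxx.
have c01 : 0 < c < 1 by rewrite c0.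
have [i [s [s_size alt_s]]] :=
  iter_nabla_sign_alt n (@pochhammer_power_cvg0 R (- a) c n c01) f0.
have drop_size : size (drop k (i :: s)) = (n - k).+1.
  by rewrite size_drop /= s_size subSn //; lia.
have alt_drop : sorted (sign_alt (fun m => (K_poly n p a).[m%:R]))
                       (drop k (i :: s)).
  have ge_k : all (leq k) (drop k (i :: s)).
    apply: sub_all (path_ltn_drop k (sign_alt_ltn alt_s)) => x.
    exact: leq_trans (leq_addl _ _).
  apply: sub_in_sorted ge_k (drop_sorted _ (alt_s : sorted _ (i :: s))).
  move=> x y kx ky /andP[lt_xy]; rewrite /sign_alt lt_xy /=.
  rewrite -!(meixner_rodrigues _ _ _ p0 _ cE) ?gt_eqF // opprK mulrACA.
  rewrite [X in is_true X -> _]pmulr_rlt0 //; exact: weight_sign.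
case: (drop _ _) drop_size alt_drop => [//|j t] /= [t_size] alt_t.
have [r [r_uniq r_size rP]] := sign_alt_roots alt_t.
exists r; split=> //; first by rewrite r_size t_size.
by move=> x /rP[jx qx]; split=> //; apply: le_lt_trans jx.
Qed.
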